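(* The tensor commutation matrix $[U_{3\otimes 3}]$ is expressed in terms of the Gell-Mann matrices $\lambda_1,\ldots,\lambda_8$ and the $3\times 3$ unit matrix $\lambda_0$ by $$[U_{3\otimes 3}]=\frac{1}{3}\,\lambda_0\otimes\lambda_0+\frac{1}{2}\sum_{i=1}^{8}\lambda_i\otimes\lambda_i .$$
   Context: $[U_{3\otimes 3}]$ is the $9\times 9$ matrix with entries $0$ and $1$ such that $[U_{3\otimes 3}]\cdot([a]\otimes[b])=[b]\otimes[a]$ for all $3\times 1$ column matrices $[a],[b]$ (over $\mathbb{C}$), where $\otimes$ is the Kronecker product of matrices (the $(i,j)$ block of $[A]\otimes[B]$ is $A^i_j[B]$). $\lambda_0$ is the $3\times3$ unit matrix, and the Gell-Mann matrices are $$\lambda_1=\begin{pmatrix}0&1&0\\1&0&0\\0&0&0\end{pmatrix},\ \lambda_2=\begin{pmatrix}0&-i&0\\i&0&0\\0&0&0\end{pmatrix},\ \lambda_3=\begin{pmatrix}1&0&0\\0&-1&0\\0&0&0\end{pmatrix},\ \lambda_4=\begin{pmatrix}0&0&1\\0&0&0\\1&0&0\end{pmatrix},$$ $$\lambda_5=\begin{pmatrix}0&0&-i\\0&0&0\\i&0&0\end{pmatrix},\ \lambda_6=\begin{pmatrix}0&0&0\\0&0&1\\0&1&0\end{pmatrix},\ \lambda_7=\begin{pmatrix}0&0&0\\0&0&-i\\0&i&0\end{pmatrix},\ \lambda_8=\frac{1}{\sqrt{3}}\begin{pmatrix}1&0&0\\0&1&0\\0&0&-2\end{pmatrix},$$ where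 inside these matrices $i$ is the imaginary unit. *)

(* Defs.v *)
From mathcomp Require Import all_boot all_order all_algebra.
From mathcomp Require Import complex mxtens.
From mathcomp Require Import reals.

Set Implicit Arguments.
Unset Strict Implicit.
Unset Printing Implicit Defensive.

Import Order.TTheory GRing.Theory Num.Theory.
Local Open Scope ring_scope.
Local Open Scope complex_scope.

(* [A *t B] of mxtens is the Kronecker product: the index of 'I_(m * p) that
   represents (i, k) is i * p + k, so the (i, j) block of A *t B is
   A i j *: B. *)

Definition is_tensor_commutation (F : fieldType) (n p : nat)
    (U : 'M[F]_(p * n, n * p)) : Prop :=
  (forall i j, U i j = 0 \/ U i j = 1) /\
  (forall (a : 'cV[F]_n) (b : 'cV[F]_p), U *m (a *t b) = b *t a).

(* The predicate singles out exactly one matrix, so that "the" tensor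
   commutation matrix may be taken to be any U that satisfies it. *)
Lemma tensor_commutation_unique_exists (F : fieldType) (n p : nat) :
  exists! U : 'M[F]_(p * n, n * p), is_tensor_commutation U.
Proof.
pose sw (k : 'I_(p * n)) : 'I_(n * p) :=
  mxtens_index ((mxtens_unindex k).2, (mxtens_unindex k).1).
exists (\matrix_(i, j) (j == sw i)%:R); split.
  split=> [i j | a b]; first by rewrite mxE; case: eqP; [right | left].
  apply/matrixP=> i j; rewrite mxE (bigD1 (sw i)) //= big1 => [|k /negPf ne].
    by rewrite !mxE eqxx mul1r addr0 mxtens_indexK /= mulrC !ord1.
  by rewrite mxE ne mul0r.
move=> V [_ Vswap]; apply/matrixP=> i k.
case: (mxtens_indexP k) => {k} x y.
have /matrixP/(_ i (mxtens_index (ord0, ord0))) :=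
  Vswap (delta_mx x 0) (delta_mx y 0).
case: (mxtens_indexP i) => {i} u v.
rewrite tensmxE mxE (bigD1 (mxtens_index (x, y))) //= big1 => [|k].
  rewrite tensmxE !mxE !eqxx !mulr1 addr0 => ->.
  rewrite /sw mxtens_indexK /= (can_eq (@mxtens_indexK _ _)) xpair_eqE.
  by rewrite !andbT -natrM mulnb andbC (eq_sym x) (eq_sym y).
case: (mxtens_indexP k) => {k} s t.
rewrite (can_eq (@mxtens_indexK _ _)) xpair_eqE => /negPf ne.
by rewrite tensmxE !mxE !andbT -natrM mulnb ne mulr0.
Qed.

(* The notation 'i is avoided: as an argument of a ring operation it denotes
   the abstract imaginary unit of a numClosedFieldType. *)
Definition Ci (R : realType) : R[i] := 0 +i* 1.

Definition mx3 (R : realType) (rows : seq (seq R[i])) : 'M[R[i]]_3 :=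
  \matrix_(i, j) nth 0 (nth [::] rows i) j.

(* gell_mann R 0 is the unit matrix lambda_0; indices above 8 are junk. *)
Definition gell_mann (R : realType) (k : nat) : 'M[R[i]]_3 :=
  let i := Ci R in
  match k with
  | 0%N => 1%:M
  | 1%N => mx3 [:: [:: 0; 1; 0];
                 [:: 1; 0; 0];
                 [:: 0; 0; 0]]
  | 2%N => mx3 [:: [:: 0; - i; 0];
                 [:: i; 0; 0];
                 [:: 0; 0; 0]]
  | 3%N => mx3 [:: [:: 1; 0; 0];
                 [:: 0; -1; 0];
                 [:: 0; 0; 0]]
  | 4%N => mx3 [:: [:: 0; 0; 1];
                 [:: 0; 0; 0];
                 [:: 1; 0; 0]]
  | 5%N => mx3 [:: [:: 0; 0; - i];
                 [:: 0; 0; 0];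
                 [:: i; 0; 0]]
  | 6%N => mx3 [:: [:: 0; 0; 0];
                 [:: 0; 0; 1];
                 [:: 0; 1; 0]]
  | 7%N => mx3 [:: [:: 0; 0; 0];
                 [:: 0; 0; - i];
                 [:: 0; i; 0]]
  | 8%N => (1 / (Num.sqrt (3 : R))%:C) *:
         mx3 [:: [:: 1; 0; 0];
                 [:: 0; 1; 0];
                 [:: 0; 0; -2]]
  | _ => 0
  end.

(* Main.v *)
Require Import Defs.
From mathcomp Require Import all_boot all_order all_algebra.
From mathcomp Require Import complex mxtens.
From mathcomp Require Import reals.
From mathcomp Require Import ring.

Import Order.TTheory GRing.Theory Num.Theory.
Local Open Scope ring_scope.
Local Open Scope complex_scope.

(** Both sides are compared entry by entry. Multiplying the tensor commutation
    matrix by the tensor product of two basis vectors reads off its columns: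
    its entry at row (u, v) and column (s, t) is 1 if u = t and v = s, and 0
    otherwise ([tensor_commutation_entry]). What remains is the completeness
    relation of the Gell-Mann matrices ([gell_mann_completeness]), i.e. the
    fact that the matrices lambda_0 / sqrt 3 and lambda_k / sqrt 2 form an
    orthonormal basis of the Hermitian matrices for the trace form. It is a
    finite computation in which the imaginary unit and the square root of 3
    occur only through their squares. *)

(** The column of index (s, t) is the product with the tensor product of the
    basis vectors of indices s and t, which the matrix must swap. *)
Lemma tensor_commutation_entry (F : fieldType) (n p : nat)
    (U : 'M[F]_(p * n, n * p)) (u : 'I_p) (v s : 'I_n) (t : 'I_p) :
  is_tensor_commutation U ->
  U (mxtens_index (u, v)) (mxtens_index (s, t)) = ((u == t) && (v == s))%:R.
Proof.
move=> [_ Uswap].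
have tens_delta : (delta_mx s 0 : 'cV[F]_n) *t (delta_mx t 0 : 'cV[F]_p)
    = delta_mx (mxtens_index (s, t)) 0.
  apply/matrixP=> k l; case: (mxtens_indexP k) => {k} x y.
  rewrite !mxE mxtens_indexK /= !ord1 !eqxx !andbT -natrM mulnb.
  by rewrite (can_eq (@mxtens_indexK _ _)) xpair_eqE.
have /matrixP/(_ (mxtens_index (u, v)) (mxtens_index (ord0, ord0))) :=
  Uswap (delta_mx s 0) (delta_mx t 0).
rewrite tens_delta -colE tensmxE !mxE => ->.
by rewrite !eqxx !andbT -natrM mulnb.
Qed.

Lemma Ci_sqr (R : realType) : Ci R * Ci R = -1.
Proof.
apply/eqP; rewrite eq_complex /= !(mul0r, mulr0, mulr1, add0r, addr0, oppr0).
by rewrite !eqxx.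
Qed.

Lemma inv_sqrt3_sqr (R : realType) :
  (1 / (Num.sqrt (3 : R))%:C) * (1 / (Num.sqrt (3 : R))%:C) = 1 / 3.
Proof.
by rewrite !div1r -invfM -rmorphM /= -expr2 sqr_sqrtr ?ler0n// rmorph_nat.
Qed.

(** Write E_xy for the matrix units. The swap is the sum of all E_xy *t E_yx.
    Of the pairs (lambda_1, lambda_2), (lambda_4, lambda_5) and
    (lambda_6, lambda_7), each has, as half the sum of the tensor squares of its
    members, E_xy *t E_yx + E_yx *t E_xy for one pair x < y; lambda_0, lambda_3
    and lambda_8 contribute the sum of the E_xx *t E_xx. *)
Lemma gell_mann_completeness (R : realType) (u v s t : 'I_3) :
  1 / 3 * (gell_mann R 0 u s * gell_mann R 0 v t)
  + 1 / 2 * \sum_(1 <= k < 9) gell_mann R k u s * gell_mann R k v t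
  = ((u == t) && (v == s))%:R.
Proof.
rewrite unlock /= !mxE.
have := Ci_sqr R; move: (Ci R) => i i_sqr.
(* The product of the entries of lambda_8 is the only one to contain sqrt 3. *)
rewrite [_ * _ * (1 / _%:C * _)]mulrACA inv_sqrt3_sqr.
move: u v s t; do 4 (case=> [[|[|[|//]]] ?]); rewrite -!val_eqE /=.
all: by field: i_sqr.
Qed.

Theorem mainTheorem9 (R : realType) (U : 'M[R[i]]_(3 * 3))
    (hU : @is_tensor_commutation R[i] 3 3 U) :
  U = (1 / 3) *: (gell_mann R 0 *t gell_mann R 0)
      + (1 / 2) *: \sum_(1 <= k < 9) (gell_mann R k *t gell_mann R k).
Proof.
apply/matrixP=> a b.
case: (mxtens_indexP a) => {a} u v; case: (mxtens_indexP b) => {b} s t.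
rewrite (tensor_commutation_entry _ _ _ _ _ _ _ _ hU) -gell_mann_completeness.
rewrite [RHS]mxE [X in _ = X + _]mxE [X in _ = _ + X]mxE tensmxE summxE.
by under [in RHS]eq_bigr do rewrite tensmxE.
Qed.
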